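(* Let $X$ and $U$ be Banach spaces. Suppose that $A$ is the generator of a polynomially stable semigroup with parameter $\alpha>0$ on $X$. If $B\in\mathcal{L}(U,X)$ satisfies $\operatorname{ran}(B)\subset D((-A)^{\beta})$ for some $\beta>\alpha$, then the linear system $\Sigma_{\mathrm{lin}}(A,B)$ is polynomially ISS with parameter $\alpha$ for $\mathcal{U}=L^\infty(\mathbb{R}_+,U)$.
   Context: $\mathcal{L}(U,X)$ denotes the bounded linear operators from $U$ to $X$; $\operatorname{ran}(B)$ is the range of $B$; $\mathbb{R}_+=[0,\infty)$; $\|u\|_\infty=\operatorname{ess\,sup}_{t\ge0}\|u(t)\|_U$. The graph norm is $\|x\|_A:=\|x\|+\|Ax\|$, $x\in D(A)$. For real functions, $f(t)=O(g(t))$ as $t\to\infty$ means there are $M>0$, $t_0$ with $f(t)\le Mg(t)$ for $t\ge t_0$. Comparison functions: $\mathcal{K}$ is the set of continuous strictly increasing $\mu:\mathbb{R}_+\to\mathbb{R}_+$ with $\mu(0)=0$; $\mathcal{K}_\infty$ is the set of unbounded $\mu\in\mathcal{K}$; $\mathcal{L}$ is the set of continuous strictly decreasing $\mu:\mathbb{R}_+\to\mathbb{R}_+$ with $\lim_{t\to\infty}\mu(t)=0$; $\mathcal{KL}$ is the set of continuous $\kappa:\mathbb{R}_+\times\mathbb{R}_+\to\mathbb{R}_+$ with $\kappa(\cdot,t)\in\mathcal{K}$ for all $t\ge0$ and $\kappa(r,\cdot)\in\mathcal{L}$ for all $r>0$. A $C_0$-semigroup $(T(t))_{t\ge0}$ on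 a Banach space with generator $A$ is semi-uniformly stable if it is uniformly bounded and $\|T(t)(I-A)^{-1}\|\to0$ as $t\to\infty$ (it is known that then $\sigma(A)\cap i\mathbb{R}=\emptyset$, so $A^{-1}$ is a bounded operator). It is polynomially stable with parameter $\alpha>0$ if it is semi-uniformly stable and $\|T(t)A^{-1}\|=O(t^{-1/\alpha})$ as $t\to\infty$. Fractional powers: for such $A$, $-A$ is sectorial with $0$ in its resolvent set, and $(-A)^\beta$ is the usual fractional power of a sectorial operator: for $0<\gamma<1$, $(-A)^{-\gamma}=\frac{\sin\pi\gamma}{\pi}\int_0^\infty s^{-\gamma}(sI-A)^{-1}\,\mathrm{d}s$; for $\beta=n+\gamma$ with $n\in\{0,1,2,\dots\}$, $0\le\gamma<1$, $(-A)^{-\beta}=(-A)^{-n}(-A)^{-\gamma}$ (with $(-A)^0=I$); $(-A)^\beta$ is the inverse of the injective operator $(-A)^{-\beta}$, with $D((-A)^\beta)=\operatorname{ran}((-A)^{-\beta})$. The linear system $\Sigma_{\mathrm{lin}}(A,B)$ is $\dot x(t)=Ax(t)+Bu(t)$, $t\ge0$, $x(0)=x_0\in X$, with $u\in L^\infty(\mathbb{R}_+,U)$; its unique mild solution is $\phi(t,x_0,u)=T(t)x_0+\int_0^tT(t-s)Bu(s)\,\mathrm{d}s$. $\Sigma_{\mathrm{lin}}(A,B)$ is uniformly globally stable (UGS) for $\mathcal{U}=L^\infty(\mathbb{R}_+,U)$ if there exist $\gamma,\mu\in\mathcal{K}_\infty$ such that $\|\phi(t,x_0,u)\|\le\gamma(\|x_0\|)+\mu(\|u\|_\infty)$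 for all $x_0\in X$, $u\in L^\infty(\mathbb{R}_+,U)$, $t\ge0$. It is polynomially input-to-state stable (polynomially ISS) with parameter $\alpha>0$ for $\mathcal{U}=L^\infty(\mathbb{R}_+,U)$ if it is UGS and there exist $\kappa\in\mathcal{KL}$ and $\mu\in\mathcal{K}_\infty$ such that $\|\phi(t,x_0,u)\|\le\kappa(\|x_0\|_A,t)+\mu(\|u\|_\infty)$ for all $x_0\in D(A)$, $u\in L^\infty(\mathbb{R}_+,U)$, $t\ge0$, and $\kappa(r,t)=O(t^{-1/\alpha})$ as $t\to\infty$ for every $r>0$. *)

(* Defs.v *)
From mathcomp Require Import all_boot all_order all_algebra.
From mathcomp Require Import complex.
From mathcomp Require Import all_classical all_reals all_analysis ess_sup_inf.

Set Implicit Arguments.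
Unset Strict Implicit.
Unset Printing Implicit Defensive.

Import Order.TTheory GRing.Theory Num.Theory.
Import numFieldNormedType.Exports.

Local Open Scope classical_set_scope.
Local Open Scope ring_scope.
Local Open Scope complex_scope.

(* The norm of a normed space over R[i] has values in R[i]; they are
   nonnegative reals, and [nrm] is the same norm with values in R. *)
Definition nrm (R : realType) (X : normedModType R[i]) (x : X) : R :=
  complex.Re `|x|.

Definition bounded_linear (R : realType) (X Y : normedModType R[i])
    (f : X -> Y) : Prop :=
  linear f /\ exists M : R, forall x, nrm (f x) <= M * nrm x.

Definition opnorm (R : realType) (X Y : normedModType R[i]) (f : X -> Y)
    : \bar R :=
  ereal_sup [set (nrm (f x))%:E | x in [set x | nrm x <= 1]].

Definition bigO_infty (R : realType) (f : R -> \bar R) (g : R -> R) : Prop :=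
  exists M t0 : R, 0 < M /\ forall t : R, t0 <= t -> (f t <= (M * g t)%:E)%E.

(* Bochner integral with respect to Lebesgue measure on a set D of reals. *)

Definition simple_fun (R : realType) (X : normedModType R[i]) (s : R -> X)
    : Prop :=
  finite_set (range s) /\ forall x, measurable (s @^-1` [set x]).

Definition strongly_measurable (R : realType) (X : normedModType R[i])
    (D : set R) (f : R -> X) : Prop :=
  exists s : nat -> R -> X, (forall n, simple_fun (s n)) /\
    {ae lebesgue_measure, forall t, D t -> s n t @[n --> \oo] --> f t}.

Definition simple_integrable (R : realType) (X : normedModType R[i])
    (D : set R) (s : R -> X) : Prop :=
  simple_fun s /\
  forall x, x != 0 -> (lebesgue_measure (D `&` s @^-1` [set x]) < +oo)%E.

(* Only the finitely many nonzero values of s contribute. *)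
Definition simple_integral (R : realType) (X : normedModType R[i])
    (D : set R) (s : R -> X) : X :=
  \sum_(x \in [set: X])
    (fine (lebesgue_measure (D `&` s @^-1` [set x])))%:C *: x.

(* Strong measurability is required separately because the integral of a
   nonnegative function in the library is a lower integral when the function
   is not measurable. *)
Definition is_bochner_integral (R : realType) (X : normedModType R[i])
    (D : set R) (f : R -> X) (y : X) : Prop :=
  strongly_measurable D f /\
  exists s : nat -> R -> X,
    [/\ forall n, simple_integrable D (s n),
        (\int[lebesgue_measure]_(t in D) (nrm (f t - s n t))%:E)%E
          @[n --> \oo] --> 0%E
      & simple_integral D (s n) @[n --> \oo] --> y].

(* 0 if f is not Bochner integrable on D. *)
Definition bochner_integral (R : realType) (X : normedModType R[i])
    (D : set R) (f : R -> X) : X :=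
  xget 0 [set y | is_bochner_integral D f y].

(* L^oo(R_+, U): functions on R of which only the restriction to R_+ matters.
   Extending the norm by 0 outside R_+ does not change the essential
   supremum, which is nonnegative. *)

Definition esssup_norm (R : realType) (U : normedModType R[i]) (u : R -> U)
    : \bar R :=
  ess_sup lebesgue_measure
    (fun t : R => if 0 <= t then (nrm (u t))%:E else 0%E).

Definition Linfty (R : realType) (U : normedModType R[i]) (u : R -> U)
    : Prop :=
  strongly_measurable `[0, +oo[ u /\ (esssup_norm u < +oo)%E.

Definition Linfty_norm (R : realType) (U : normedModType R[i]) (u : R -> U)
    : R := fine (esssup_norm u).

(* Unbounded operators; the values of [app] outside [dom] are irrelevant. *)

Record partial_op (V : Type) := PartialOp { dom : set V; app : V -> V }.

Definition op_inv (R : realType) (X : normedModType R[i]) (P : partial_op X)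
    : partial_op X :=
  PartialOp (app P @` dom P)
    (fun y => xget 0 [set x | dom P x /\ app P x = y]).

Definition graph_norm (R : realType) (X : normedModType R[i])
    (A : partial_op X) (x : X) : R := nrm x + nrm (app A x).

(* (lam I - A)^{-1}, meaningful for lam in the resolvent set of A. *)
Definition resolvent (R : realType) (X : normedModType R[i])
    (A : partial_op X) (lam : R[i]) : X -> X :=
  app (op_inv (PartialOp (dom A) (fun x => lam *: x - app A x))).

(* (-A)^{-gam} for 0 < gam < 1, as an integral in the strong sense. *)
Definition neg_frac_power_lt1 (R : realType) (X : normedModType R[i])
    (A : partial_op X) (gam : R) (x : X) : X :=
  (sin (pi * gam) / pi)%:C *:
    bochner_integral `]0, +oo[
      (fun s => (s `^ (- gam))%:C *: resolvent A s%:C x).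

(* (-A)^{-beta} for beta >= 0; note that (-A)^{-1} is [resolvent A 0]. *)
Definition neg_frac_power (R : realType) (X : normedModType R[i])
    (A : partial_op X) (beta : R) (x : X) : X :=
  let n := Num.truncn beta in
  let gam := beta - n%:R in
  iter n (resolvent A 0)
    (if gam == 0 then x else neg_frac_power_lt1 A gam x).

(* (-A)^beta for beta >= 0. *)
Definition frac_power (R : realType) (X : normedModType R[i])
    (A : partial_op X) (beta : R) : partial_op X :=
  op_inv (PartialOp [set: X] (neg_frac_power A beta)).

(* Only the operators T t with t >= 0 matter. *)
Definition C0_semigroup (R : realType) (X : normedModType R[i])
    (T : R -> X -> X) : Prop :=
  [/\ forall t : R, 0 <= t -> bounded_linear (T t),
      forall x, T 0 x = x,
      forall (s t : R) x, 0 <= s -> 0 <= t -> T (s + t) x = T s (T t x)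
    & forall x, T h x @[h --> 0^'+] --> x].

(* The graph of A is the set of pairs (x, y) such that the difference
   quotients of T at x converge to y. *)
Definition is_generator (R : realType) (X : normedModType R[i])
    (A : partial_op X) (T : R -> X -> X) : Prop :=
  forall x y, (dom A x /\ app A x = y) <->
    (h^-1%:C *: (T h x - x) @[h --> 0^'+] --> y).

Definition uniformly_bounded (R : realType) (X : normedModType R[i])
    (T : R -> X -> X) : Prop :=
  exists M : R, forall t : R, 0 <= t -> (opnorm (T t) <= M%:E)%E.

Definition semi_uniformly_stable (R : realType) (X : normedModType R[i])
    (A : partial_op X) (T : R -> X -> X) : Prop :=
  uniformly_bounded T /\
  opnorm (T t \o resolvent A 1) @[t --> +oo] --> 0%E.

Definition polynomially_stable (R : realType) (X : normedModType R[i])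
    (A : partial_op X) (T : R -> X -> X) (alpha : R) : Prop :=
  semi_uniformly_stable A T /\
  bigO_infty (fun t => opnorm (T t \o app (op_inv A)))
             (fun t => t `^ (- alpha^-1)).

(* Comparison functions are functions on R of which only the values on R_+
   matter. *)

Definition classK (R : realType) (mu : R -> R) : Prop :=
  [/\ {within `[0, +oo[, continuous mu},
      forall r : R, 0 <= r -> 0 <= mu r,
      forall r s : R, 0 <= r -> r < s -> mu r < mu s
    & mu 0 = 0].

Definition classKinf (R : realType) (mu : R -> R) : Prop :=
  classK mu /\ forall M : R, exists r : R, 0 <= r /\ M < mu r.

Definition classL (R : realType) (mu : R -> R) : Prop :=
  [/\ {within `[0, +oo[, continuous mu},
      forall t : R, 0 <= t -> 0 <= mu t,
      forall s t : R, 0 <= s -> s < t -> mu t < mu s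
    & mu t @[t --> +oo] --> 0].

Definition classKL (R : realType) (kappa : R -> R -> R) : Prop :=
  [/\ {within [set p : R * R | 0 <= p.1 /\ 0 <= p.2],
        continuous (fun p : R * R => kappa p.1 p.2)},
      forall t : R, 0 <= t -> classK (fun r => kappa r t)
    & forall r : R, 0 < r -> classL (kappa r)].

(* The mild solution of x' = A x + B u, x(0) = x0, where T is the semigroup
   generated by A. *)
Definition mild_solution (R : realType) (X U : normedModType R[i])
    (T : R -> X -> X) (B : U -> X) (t : R) (x0 : X) (u : R -> U) : X :=
  T t x0 + bochner_integral `[0, t] (fun s => T (t - s) (B (u s))).

Definition UGS (R : realType) (X U : normedModType R[i])
    (T : R -> X -> X) (B : U -> X) : Prop :=
  exists gam mu : R -> R, [/\ classKinf gam, classKinf mu &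
    forall (x0 : X) (u : R -> U) (t : R), Linfty u -> 0 <= t ->
      nrm (mild_solution T B t x0 u) <= gam (nrm x0) + mu (Linfty_norm u)].

Definition polynomially_ISS (R : realType) (X U : normedModType R[i])
    (A : partial_op X) (T : R -> X -> X) (B : U -> X) (alpha : R) : Prop :=
  UGS T B /\
  exists (kappa : R -> R -> R) (mu : R -> R),
    [/\ classKL kappa, classKinf mu,
        forall (x0 : X) (u : R -> U) (t : R), dom A x0 -> Linfty u -> 0 <= t ->
          nrm (mild_solution T B t x0 u)
            <= kappa (graph_norm A x0) t + mu (Linfty_norm u)
      & forall r : R, 0 < r ->
          bigO_infty (fun t => (kappa r t)%:E) (fun t => t `^ (- alpha^-1))].

(* Main.v *)
Require Import Defs.
From mathcomp Require Import all_boot all_order all_algebra.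
From mathcomp Require Import complex finmap.
From mathcomp Require Import all_classical all_reals all_analysis.
From mathcomp Require Import measurable_realfun ess_sup_inf.
From mathcomp Require Import ring lra.

Set Implicit Arguments.
Unset Strict Implicit.
Unset Printing Implicit Defensive.

Import Order.TTheory GRing.Theory Num.Theory.
Import numFieldNormedType.Exports.

Local Open Scope classical_set_scope.
Local Open Scope ring_scope.
Local Open Scope complex_scope.

(** Everything rests on the decay [nrm (T t (B u)) <= C (1 + t)^(- d) nrm u] with
    [d = beta / alpha > 1]: its right-hand side is integrable in [t], so the
    forced response is bounded by a constant times the supremum norm of the input,
    uniformly in time, while the free response [T t x0] decays like
    [(1 + t)^(- 1 / alpha)] in the graph norm of [x0].

    The decay comes from powers of [(- A)^-1]. Polynomial stability gives
    [nrm (T t z) <= a nrm (A z)] with [a] of order [(1 + t)^(- 1 / alpha)]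
    ([generator_decay]), so [n] factors [(- A)^-1] give the rate [a ^ n]
    ([iter_resolvent0_decay]). A factor [(- A)^(- gam)] with [0 < gam < 1] gives
    [a ^ gam]: in the integral that defines it, [T t] applied to the resolvent at
    [s] has norm at most a multiple of [a] and at most a multiple of [s^-1], and
    the integral is split at [s = a^-1] ([neg_frac_power_lt1_decay]). Together,
    [T t] composed with [(- A)^(- beta)] decays like [a ^ beta]
    ([neg_frac_power_decay]).

    Since every [B u] is a value of [(- A)^(- beta)], the operators
    [(1 + t)^d T t B] are pointwise bounded; the uniform boundedness principle makes
    the bound uniform ([input_decay]). This takes the place of the closed graph
    theorem for [(- A)^beta B].

    All facts about the resolvent are a priori estimates for elements of the domain
    of [A]. Inverses and integrals take the value [0] where they do not exist, and
    [0] satisfies each of the norm bounds, so the estimates hold for [resolvent] and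
    [bochner_integral] at every argument. The resolvent estimate
    [s nrm x <= M nrm (s x - A x)] is read off the difference quotient
    ([resolvent_bound]). *)

(** * Norms with values in the reals *)

Section RealNorm.
Context {R : realType} {X : normedModType R[i]}.
Implicit Types (x y : X) (e : R).

Lemma nrmE x : `|x| = (nrm x)%:C.
Proof. by rewrite /nrm RRe_real// ger0_real. Qed.

Lemma nrm_ge0 x : 0 <= nrm x.
Proof. by rewrite -ler0c -nrmE. Qed.

Lemma nrm0 : nrm (0 : X) = 0.
Proof. by rewrite /nrm normr0. Qed.

Lemma nrm_le0 x : nrm x <= 0 -> x = 0.
Proof.
move=> x0; apply/eqP; rewrite -normr_eq0 nrmE.
suff -> : nrm x = 0 by [].
by apply/eqP; rewrite eq_le x0 nrm_ge0.
Qed.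

Lemma nrmD x y : nrm (x + y) <= nrm x + nrm y.
Proof. by have := ler_normD x y; rewrite !nrmE -rmorphD /= lecR. Qed.

Lemma nrmN x : nrm (- x) = nrm x.
Proof. by rewrite /nrm normrN. Qed.

Lemma nrmB x y : nrm (x - y) <= nrm x + nrm y.
Proof. by rewrite -(nrmN y) nrmD. Qed.

Lemma nrmZ (a : R) x : nrm (a%:C *: x) = `|a| * nrm x.
Proof. by rewrite {1}/nrm normrZ nrmE normc_def /= expr0n addr0 sqrtr_sqr mulr0 subr0. Qed.

Lemma nrm_sum (I : Type) (r : seq I) (P : pred I) (F : I -> X) :
  nrm (\sum_(i <- r | P i) F i) <= \sum_(i <- r | P i) nrm (F i).
Proof.
elim/big_ind2 : _ => //; first by rewrite nrm0.
by move=> x a y b xa yb; rewrite (le_trans (nrmD _ _))// lerD.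
Qed.

Lemma cvg_nrmP {T : Type} (F : set_system T) {FF : Filter F} (f : T -> X) y :
  f @ F --> y <-> forall e, 0 < e -> \forall t \near F, nrm (f t - y) < e.
Proof.
split=> [/cvgrPdist_lt H e e0|H].
  have := H e%:C; rewrite ltcR => /(_ e0).
  by apply: filterS => t; rewrite distrC nrmE ltcR.
apply/cvgrPdist_lt => -[e e'] /=; rewrite ltcE /= => /andP[/eqP-> e0].
by near=> t; rewrite distrC nrmE (@ltcR R); near: t; exact: H.
Unshelve. all: by end_near. Qed.

End RealNorm.

Section BoundedLinear.
Context {R : realType} {X Y : normedModType R[i]} {f : X -> Y}.
Hypothesis lf : linear f.

Lemma linear_add x y : f (x + y) = f x + f y.
Proof. by have := lf 1 x y; rewrite !scale1r. Qed.

Lemma linear_zero : f 0 = 0.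
Proof. by apply/(addrI (f 0)); rewrite -linear_add !addr0. Qed.

Lemma linear_scale a x : f (a *: x) = a *: f x.
Proof. by have := lf a x 0; rewrite !addr0 linear_zero addr0. Qed.

Lemma linear_sub x y : f (x - y) = f x - f y.
Proof. by rewrite linear_add -scaleN1r linear_scale scaleN1r. Qed.

Lemma linear_bigsum (I : Type) (r : seq I) (P : pred I) (F : I -> X) :
  f (\sum_(i <- r | P i) F i) = \sum_(i <- r | P i) f (F i).
Proof.
elim/big_ind2 : _ => //; first exact: linear_zero.
by move=> x a y b <- <-; rewrite linear_add.
Qed.

Lemma opnorm_nrm_le (M : R) : (opnorm f <= M%:E)%E ->
  forall x, nrm (f x) <= M * nrm x.
Proof.
move=> fM x; have [x0|x0] := eqVneq (nrm x) 0.
  by rewrite (@nrm_le0 _ _ x) ?x0// linear_zero !nrm0 mulr0.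
have {}x0 : 0 < nrm x by rewrite lt0r x0 nrm_ge0.
rewrite -ler_pdivrMr// mulrC -[X in X * _]ger0_norm ?invr_ge0 ?nrm_ge0//.
rewrite -nrmZ -linear_scale -lee_fin (le_trans _ fM)//.
apply: ereal_sup_ubound => /=; exists ((nrm x)^-1%:C *: x) => //=.
by rewrite nrmZ ger0_norm ?invr_ge0 ?nrm_ge0// mulVf ?gt_eqF.
Qed.

Lemma bounded_linear_cvg {T : Type} (F : set_system T) {FF : Filter F}
    (M : R) (g : T -> X) y :
  (forall x, nrm (f x) <= M * nrm x) -> g @ F --> y -> f (g t) @[t --> F] --> f y.
Proof.
move=> fM /cvg_nrmP gy; apply/cvg_nrmP => e e0.
have M0 : 0 < `|M| + 1 by rewrite ltr_wpDl.
have := gy (e / (`|M| + 1)); rewrite divr_gt0// => /(_ isT).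
apply: filterS => t; rewrite ltr_pdivlMr// => te.
rewrite -linear_sub (le_lt_trans _ te)// (le_trans (fM _))// mulrC.
by rewrite ler_wpM2l ?nrm_ge0// (le_trans (ler_norm M))// lerDl.
Qed.

End BoundedLinear.

(** If the family were unbounded on every ball, one could choose nested closed
    balls with centres [x n] and radii [r n] such that some [F i] has norm larger
    than [n] on the whole of the ball number [n.+1]; the common point of the balls,
    which exists by completeness, would contradict pointwise boundedness. *)
Lemma uniform_boundedness {R : realType} {U : completeNormedModType R[i]}
    {X : normedModType R[i]} (I : Type) (F : I -> U -> X) :
  (forall i, bounded_linear (F i)) ->
  (forall u, exists C : R, forall i, nrm (F i u) <= C) ->
  exists C : R, forall i u, nrm (F i u) <= C * nrm u.
Proof.
move=> bF pF.
suff [x0 [r [K [r0 K0 xrK]]]] : exists x0 (r K : R), [/\ 0 < r, 0 <= K &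
    forall i x, nrm (x - x0) <= r -> nrm (F i x) <= K].
  (* A vector of norm [r] is a difference of two points of the ball. *)
  exists (K *+ 2 / r) => i u; have [lF _] := bF i.
  have [u0|u0] := eqVneq (nrm u) 0.
    by rewrite (@nrm_le0 _ _ u) ?u0// (linear_zero lF) !nrm0 mulr0.
  have {}u0 : 0 < nrm u by rewrite lt0r u0 nrm_ge0.
  set c := r / nrm u.
  have c0 : 0 < c by rewrite divr_gt0.
  have : nrm (F i (c%:C *: u)) <= K *+ 2.
    have -> : c%:C *: u = (x0 + c%:C *: u) - x0 by rewrite addrAC subrr add0r.
    rewrite (linear_sub lF) (le_trans (nrmB _ _))// mulr2n lerD//; apply: xrK.
      by rewrite addrAC subrr add0r nrmZ gtr0_norm// /c divfK ?gt_eqF.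
    by rewrite subrr nrm0 ltW.
  rewrite (linear_scale lF) nrmZ gtr0_norm// mulrC -ler_pdivlMr// => /le_trans.
  by apply; rewrite /c invf_div mulrA [X in _ <= X]mulrAC.
apply: contrapT => noball.
have unb (x0 : U) (r K : R) : 0 < r -> exists (p : U * R),
    [/\ nrm (p.1 - x0) <= r, 0 < p.2 & exists i, forall y,
      nrm (y - p.1) <= p.2 -> K < nrm (F i y)].
  move=> r0; apply: contrapT => H; apply: noball.
  exists x0, r, (`|K| + 1); split => // i x xr.
  rewrite leNgt; apply/negP => Kx; apply: H.
  have [lF [M FM]] := bF i.
  have M0 : 0 < `|M| + 1 by rewrite ltr_wpDl.
  (* On a ball of this radius [F i] varies by at most [1], which is why
     [`|K| + 1] was used to select [x]. *)
  exists (x, (`|M| + 1)^-1); split => /=; [by []|by rewrite invr_gt0|].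
  exists i => y xy.
  have : nrm (F i (x - y)) <= 1.
    rewrite (le_trans (FM _))// -(nrmN (x - y)) opprB.
    rewrite (le_trans (ler_wpM2r (nrm_ge0 _) (ler_norm M)))//.
    rewrite (@le_trans _ _ ((`|M| + 1) * nrm (y - x)))//.
      by rewrite ler_wpM2r ?nrm_ge0// lerDl.
    by rewrite mulrC -ler_pdivlMr// mul1r.
  rewrite (linear_sub lF) => xy1.
  have : nrm (F i x) <= nrm (F i x - F i y) + nrm (F i y).
    by rewrite -{1}(subrK (F i y) (F i x)) nrmD.
  move=> /(lt_le_trans Kx); rewrite -ltrBlDl => /(le_lt_trans _); apply.
  rewrite (le_trans (ler_norm _))// lerBrDr.
  by rewrite lerD2l.
pose St := {p : U * R | 0 < p.2}.
have step (n : nat) (p : St) : exists q : St,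
    [/\ nrm ((sval q).1 - (sval p).1) <= (sval p).2 / 2,
        (sval q).2 <= (sval p).2 / 2 &
        exists i, forall y, nrm (y - (sval q).1) <= (sval q).2 -> n%:R < nrm (F i y)].
  case: p => -[x0 r] /= r0.
  have r20 : 0 < r / 2 by rewrite divr_gt0.
  have [[x s] /= [xr s0 [i Fi]]] := unb x0 (r / 2) n%:R r20.
  have m0 : 0 < Num.min s (r / 2) by rewrite lt_min s0.
  exists (exist _ (x, Num.min s (r / 2)) m0); split => //=.
    by rewrite ge_min lexx orbT.
  by exists i => y xy; apply: Fi; rewrite (le_trans xy)// ge_min lexx.
have s0 : 0 < (0 : U, 1 : R).2 by [].
have [next nextP] := choice (fun np : nat * St => step np.1 np.2).
pose p := fix p n : St := if n is m.+1 then next (m, p m) else exist _ (0, 1) s0.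
pose x n := (sval (p n)).1; pose r n := (sval (p n)).2.
have pS n : [/\ nrm (x n.+1 - x n) <= r n / 2, r n.+1 <= r n / 2 &
    exists i, forall y, nrm (y - x n.+1) <= r n.+1 -> n%:R < nrm (F i y)].
  by have := nextP (n, p n).
have r_gt0 n : 0 < r n by exact: svalP (p n).
have nest n k : nrm (x (k + n)%N - x n) <= r n - r (k + n)%N.
  elim: k => [|k IH]; first by rewrite !subrr nrm0.
  have [h1 h2 _] := pS (k + n)%N.
  rewrite -(subrK (x (k + n)%N) (x (k.+1 + n)%N)) -addrA.
  rewrite (le_trans (nrmD _ _))// (le_trans (lerD h1 IH))//.
  by move: h2; rewrite addSn; lra.
have r_small n : r n <= geometric 1 2^-1 n.
  rewrite /geometric /= mul1r.
  elim: n => [|n IH]; first by rewrite /r /= expr0.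
  by have [_ h _] := pS n; rewrite (le_trans h)// exprSr ler_pM2r.
have /cvg_ex[/= z xz] : cvg (x @ \oo).
  apply/cauchy_cvgP/cauchy_exP => -[e e'] /=; rewrite ltcE /= => /andP[/eqP-> e0].
  near \oo => n.
  exists (x n); near=> m; rewrite -ball_normE /= distrC nrmE (@ltcR R).
  have -> : m = ((m - n) + n)%N by rewrite subnK//; near: m; exact: nbhs_infty_ge.
  rewrite (le_lt_trans (nest _ _))// ltrBlDr ltr_wpDr//; first exact: ltW.
  rewrite (le_lt_trans (r_small _))//; near: n.
  have half1 : `|2^-1 : R| < 1 by rewrite ger0_norm ?invr_ge0// invf_lt1 ?ltr1n.
  have /cvgrPdist_lt /(_ e e0) := cvg_geometric 1 half1.
  by apply: filterS => n; rewrite sub0r normrN; apply: le_lt_trans; exact: ler_norm.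
have zball n : nrm (z - x n) <= r n.
  apply/ler_addgt0Pr => e e0.
  move/cvg_nrmP : xz => /(_ e e0) xz.
  near \oo => m.
  have -> : z - x n = - (x m - z) + (x m - x n) by rewrite opprB addrA subrK.
  rewrite (le_trans (nrmD _ _))// addrC lerD//.
    have -> : m = ((m - n) + n)%N by rewrite subnK//; near: m; exact: nbhs_infty_ge.
    by rewrite (le_trans (nest _ _))// gerBl ltW.
  by rewrite nrmN ltW//; near: m.
have [C zC] := pF z.
have [n Cn] : exists n : nat, C <= n%:R.
  by exists (Num.truncn C).+1; rewrite ltW// truncnS_gt.
have [_ _ [i Fi]] := pS n.
by have := Fi _ (zball n.+1); rewrite ltNge (le_trans (zC i)).
Unshelve. all: by end_near. Qed.

(** * Bounded semigroups and their generators *)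

Section BoundedSemigroup.
Context {R : realType} {X : normedModType R[i]} {A : partial_op X}
  {T : R -> X -> X} {M : R}.
Hypothesis hT : C0_semigroup T.
Hypothesis hA : is_generator A T.
Hypothesis M0 : 0 <= M.
Hypothesis hM : forall (t : R) (x : X), 0 <= t -> nrm (T t x) <= M * nrm x.

Lemma semigroup_linear (t : R) : 0 <= t -> linear (T t).
Proof. by move=> t0; have [+ _ _ _] := hT; case/(_ t t0). Qed.

Lemma generator_expansion x (e : R) : dom A x -> 0 < e ->
  \forall h \near 0^'+, nrm (T h x - x - h%:C *: app A x) <= h * e.
Proof.
move=> Ax e0.
have [+ _] := hA x (app A x); move=> /(_ (conj Ax erefl)) /cvg_nrmP /(_ e e0) H.
near=> h.
have h0 : 0 < h by near: h; exact: nbhs_right_gt.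
have : nrm (h^-1%:C *: (T h x - x) - app A x) < e by near: h.
move=> /ltW; rewrite -(@ler_pM2l _ h)//; apply: le_trans.
rewrite -[X in X * _](gtr0_norm h0) -nrmZ scalerBr scalerA -rmorphM /= divff ?gt_eqF//.
by rewrite scale1r.
Unshelve. all: by end_near. Qed.

Lemma generator_linear c x y : dom A x -> dom A y ->
  dom A (c *: x + y) /\ app A (c *: x + y) = c *: app A x + app A y.
Proof.
move=> Ax Ay; apply/hA.
have [+ _] := hA x (app A x); move=> /(_ (conj Ax erefl)) hx.
have [+ _] := hA y (app A y); move=> /(_ (conj Ay erefl)) hy.
have cAxy : c *: (h^-1%:C *: (T h x - x)) + h^-1%:C *: (T h y - y) @[h --> 0^'+]
    --> c *: app A x + app A y.
  by apply: cvgD => //; apply: cvgZr.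
apply: cvg_trans cAxy; apply: near_eq_cvg; near=> h.
have h0 : 0 <= h by near: h; exact: nbhs_right_ge.
rewrite scalerA mulrC -scalerA -scalerDr; congr (_ *: _).
rewrite semigroup_linear// scalerBr opprD addrACA.
by [].
Unshelve. all: by end_near. Qed.

Lemma generator_semigroup (t : R) x : 0 <= t -> dom A x ->
  dom A (T t x) /\ app A (T t x) = T t (app A x).
Proof.
move=> t0 Ax; apply/hA; have lT := semigroup_linear t0.
have [+ _] := hA x (app A x); move=> /(_ (conj Ax erefl)).
move=> /(bounded_linear_cvg lT (fun x => hM x t0)) TAx.
apply: cvg_trans TAx; apply: near_eq_cvg; near=> h.
have h0 : 0 <= h by near: h; exact: nbhs_right_ge.
have [_ _ TD _] := hT.
rewrite (linear_scale lT) (linear_sub lT) -!TD// (addrC t).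
Unshelve. all: by end_near. Qed.

(** [T t x - x] is the sum of the [n] increments [T (k t / n) (T (t / n) x - x)],
    each of norm at most [M nrm (T (t / n) x - x)], and the expansion at [0]
    evaluates the latter. *)
Lemma semigroup_increment (t : R) x : 0 <= t -> dom A x ->
  nrm (T t x - x) <= M * t * nrm (app A x).
Proof.
have [_ T0 TD _] := hT.
rewrite le_eqVlt => /predU1P[<- _|t0 Ax].
  by rewrite T0 subrr nrm0 mulr0 mul0r.
have tele h n : 0 <= h ->
    nrm (T (n%:R * h) x - x) <= n%:R * (M * nrm (T h x - x)).
  move=> h0; elim: n => [|n IH]; first by rewrite !mul0r T0 subrr nrm0.
  have nh0 : 0 <= n%:R * h by rewrite mulr_ge0.
  rewrite -natr1 !mulrDl !mul1r TD// -(subrK (T (n%:R * h) x) (T (n%:R * h) (T h x))).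
  rewrite -addrA (le_trans (nrmD _ _))// [leRHS]addrC lerD//.
  by rewrite -(linear_sub (semigroup_linear nh0)) hM.
apply/ler_addgt0Pr => e e0.
(* An error [M * (h * d)] at each of the [t / h] steps adds up to at most [e]. *)
pose d := e / (M * t + 1).
have Mt1 : 0 < M * t + 1 by rewrite ltr_wpDl// mulr_ge0// ltW.
have d0 : 0 < d by rewrite divr_gt0.
have Ad := generator_expansion Ax d0.
have [r /= r0 rd] := Ad.
pose n := Num.truncn (t / r); pose h := t / n.+1%:R.
have h0 : 0 < h by rewrite divr_gt0.
have hd : nrm (T h x - x - h%:C *: app A x) <= h * d.
  apply: rd => //=; rewrite sub0r normrN gtr0_norm// ltr_pdivrMr// mulrC.
  by rewrite -ltr_pdivrMr// truncnS_gt.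
have := tele h n.+1 (ltW h0).
rewrite {1}/h mulrCA divff ?pnatr_eq0// mulr1 => /le_trans; apply.
have : nrm (T h x - x) <= h * (nrm (app A x) + d).
  rewrite -(subrK (h%:C *: app A x) (T h x - x)) (le_trans (nrmD _ _))//.
  by rewrite nrmZ gtr0_norm// mulrDr addrC lerD2l.
move=> hxd.
rewrite (@le_trans _ _ (n.+1%:R * (M * (h * (nrm (app A x) + d)))))//.
  by rewrite ler_wpM2l// ler_wpM2l.
have -> : n.+1%:R * (M * (h * (nrm (app A x) + d))) = M * t * nrm (app A x) + M * t * d.
  have : n.+1%:R != 0 :> R by rewrite pnatr_eq0.
  by rewrite /h; move: (n.+1%:R) => k k0; field.
rewrite lerD2l /d mulrCA ler_piMr ?(ltW e0)// ler_pdivrMr// mul1r.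
by rewrite lerDl.
Unshelve. all: by end_near. Qed.

(** Let [S] be the supremum of the norm along the orbit of [x] and
    [y = s x - A x]. The expansion [(1 + h s) T t x = T (t + h) x + h T t y + o(h)]
    gives [(1 + h s) S <= S + h M nrm y + o(h)], that is [s S <= M nrm y]. *)
Lemma resolvent_bound (s : R) x : 0 < s -> dom A x ->
  s * nrm x <= M * nrm (s%:C *: x - app A x).
Proof.
move=> s0 Ax; set y := s%:C *: x - app A x.
have [_ T0 TD _] := hT.
pose O := [set nrm (T t x) | t in [set t | 0 <= t]].
have OS : has_sup O.
  split; first by exists (nrm (T 0 x)), 0 => /=.
  by exists (M * nrm x) => _ [t t0 <-]; exact: hM.
have xS : nrm x <= sup O by apply: sup_ubound; [case: OS|exists 0 => //=; rewrite T0].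
rewrite (le_trans (ler_wpM2l (ltW s0) xS))//.
apply/ler_addgt0Pr => e e0.
pose d := e / (M + 1).
have d0 : 0 < d by rewrite divr_gt0// ltr_wpDl.
have Ad := generator_expansion Ax d0.
near (0 : R)^'+ => h.
have h0 : 0 < h by near: h; exact: nbhs_right_gt.
have hd : nrm (T h x - x - h%:C *: app A x) <= h * d by near: h.
have key t : 0 <= t -> (1 + h * s) * nrm (T t x) <= sup O + h * (M * nrm y + e).
  move=> t0; have lT := semigroup_linear t0.
  have hs0 : 0 <= 1 + h * s by rewrite addr_ge0// mulr_ge0// ltW.
  rewrite -[X in X * _](ger0_norm hs0) -nrmZ -(linear_scale lT).
  have -> : (1 + h * s)%:C *: x = T h x + h%:C *: y - (T h x - x - h%:C *: app A x).
    rewrite /y scalerBr scalerA rmorphD rmorph1 rmorphM/= scalerDl scale1r.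
    by rewrite !opprB addrA -(addrA (T h x)) subrK addrC addrA subrK.
  rewrite (linear_sub lT) (le_trans (nrmB _ _))// (linear_add lT).
  rewrite -TD// ?(ltW h0)// mulrDr addrA lerD//.
    rewrite (le_trans (nrmD _ _))// lerD//.
      by apply: sup_ubound; [case: OS|exists (t + h) => //=; rewrite addr_ge0// ltW].
    by rewrite (le_trans (hM _ t0))// nrmZ gtr0_norm// mulrCA.
  rewrite (le_trans (hM _ t0))// (le_trans (ler_wpM2l M0 hd))// mulrCA ler_pM2l//.
  rewrite /d mulrCA ler_piMr ?(ltW e0)// ler_pdivrMr ?ltr_wpDl// mul1r.
  by rewrite lerDl.
have hs0 : 0 < 1 + h * s by rewrite addr_gt0// mulr_gt0.
have : sup O <= (sup O + h * (M * nrm y + e)) / (1 + h * s).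
  by apply: ge_sup => [|_ [t t0 <-]]; [case: OS|rewrite ler_pdivlMr// mulrC key].
rewrite ler_pdivlMr// mulrDr mulr1 lerD2l mulrCA ler_pM2l// (mulrC (sup O)).
Unshelve. all: by end_near. Qed.

End BoundedSemigroup.

(** * Decay of orbits starting in the domain of the generator *)

Lemma powR_anti {R : realType} (p a b : R) : 0 <= p -> 0 < a -> a <= b ->
  b `^ (- p) <= a `^ (- p).
Proof.
move=> p0 a0 ab; rewrite !powRN lef_pV2 ?posrE ?powR_gt0 ?(lt_le_trans a0)//.
by rewrite ge0_ler_powR ?nnegrE ?(ltW a0)// (le_trans (ltW a0)).
Qed.

Lemma opnorm_ge {R : realType} {X Y : normedModType R[i]} (f : X -> Y) x :
  nrm x <= 1 -> ((nrm (f x))%:E <= opnorm f)%E.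
Proof. by move=> x1; apply: ereal_sup_ubound; exists x. Qed.

Lemma uniformly_boundedP {R : realType} {X : normedModType R[i]} (T : R -> X -> X) :
  C0_semigroup T -> uniformly_bounded T ->
  exists2 M : R, 0 <= M &
    forall (t : R) x, 0 <= t -> nrm (T t x) <= M * nrm x.
Proof.
move=> hT [M hM]; exists (Num.max M 0); first by rewrite le_max lexx orbT.
move=> t x t0; rewrite (le_trans (opnorm_nrm_le (semigroup_linear hT t0) (hM _ t0) x))//.
by rewrite ler_wpM2r ?nrm_ge0// le_max lexx.
Qed.

Section Stable.
Context {R : realType} {X : normedModType R[i]} {A : partial_op X}
  {T : R -> X -> X} {M : R}.
Hypothesis hT : C0_semigroup T.
Hypothesis hA : is_generator A T.
Hypothesis M0 : 0 <= M.
Hypothesis hM : forall (t : R) (x : X), 0 <= t -> nrm (T t x) <= M * nrm x.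

Lemma generator_scale c x : dom A x -> dom A (c *: x) /\ app A (c *: x) = c *: app A x.
Proof.
move=> Ax.
have [A0 A0E] : dom A 0 /\ app A 0 = 0.
  have := generator_linear hT hA (-1) Ax Ax.
  by rewrite !scaleN1r !addNr.
by have := generator_linear hT hA c Ax A0; rewrite A0E !addr0.
Qed.

Lemma resolvent_inj (s : R) x y : 0 < s -> dom A x -> dom A y ->
  s%:C *: x - app A x = s%:C *: y - app A y -> x = y.
Proof.
move=> s0 Ax Ay xy; apply/eqP; rewrite -subr_eq0; apply/eqP/nrm_le0.
have [] := generator_linear hT hA (-1) Ay Ax.
rewrite !scaleN1r [- y + x]addrC [- app A y + _]addrC => Axy AxyE.
rewrite -(pmulr_rle0 _ s0) (le_trans (resolvent_bound hT hA M0 hM s0 Axy))//.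
by rewrite AxyE scalerBr opprD addrACA -opprD xy subrr nrm0 mulr0.
Qed.

(** A nonzero kernel vector would be a fixed point of the semigroup and of the
    resolvent at [1], so it could not be damped by [T t \o resolvent A 1]. *)
Lemma generator_ker x : opnorm (T t \o resolvent A 1) @[t --> +oo] --> 0%E ->
  dom A x -> app A x = 0 -> x = 0.
Proof.
move=> T0 Ax Ax0; apply: contrapT => /eqP x0.
have {}x0 : 0 < nrm x.
  rewrite lt_neqAle nrm_ge0 eq_sym andbT; apply: contra x0 => /eqP x0.
  by apply/eqP/nrm_le0; rewrite x0.
pose c := (nrm x)^-1; pose z := c%:C *: x.
have z1 : nrm z = 1 by rewrite nrmZ ger0_norm ?invr_ge0 ?nrm_ge0// mulVf ?gt_eqF.
have [Az Az0] := generator_scale c%:C Ax; rewrite Ax0 scaler0 in Az0.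
have Tz t : 0 <= t -> T t z = z.
  move=> t0; apply/eqP; rewrite -subr_eq0; apply/eqP/nrm_le0.
  by have := semigroup_increment hT hA M0 hM t0 Az; rewrite -/z Az0 nrm0 mulr0.
have resz : resolvent A 1 z = z.
  rewrite /resolvent /=; set S := [set _ | _].
  have : S (xget 0 S).
    by apply: (@xgetPex _ _ S); exists z; split => //; rewrite -/z Az0 subr0 scale1r.
  set w := xget 0 S => -[Aw Ew].
  apply: (@resolvent_inj 1) => //; rewrite Ew -/z Az0 subr0 scale1r//.
have lt1 : \forall t \near +oo, (opnorm (T t \o resolvent A 1%R) < 1)%E.
  by apply: (T0 (fun u => (u < 1)%E)); apply: open_ereal_lt'; rewrite lte_fin ltr01.
near (pinfty_nbhs R) => t.
have : (opnorm (T t \o resolvent A 1%R) < 1)%E by near: t.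
rewrite ltNge => /negP; apply.
have t0 : 0 <= t by near: t; exact: nbhs_pinfty_ge.
by have := @opnorm_ge R X X (T t \o resolvent A 1) z; rewrite /= resz Tz// z1; apply.
Unshelve. all: by end_near. Qed.

(** Injectivity of [A] identifies the value chosen by [op_inv]. *)
Lemma inverse_generator x : opnorm (T t \o resolvent A 1) @[t --> +oo] --> 0%E ->
  dom A x -> app (op_inv A) (app A x) = x.
Proof.
move=> T0 Ax; rewrite /op_inv /=; set S := [set _ | _].
have : S (xget 0 S) by apply: (@xgetPex _ _ S); exists x.
move=> [Aw Ew]; apply/eqP; rewrite -subr_eq0; apply/eqP.
have [] := generator_linear hT hA (-1) Ax Aw.
rewrite !scaleN1r addrC [- app A x + _]addrC Ew subrr => Az Az0.
exact: generator_ker.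
Qed.

(** Polynomial stability bounds [T t] for large [t]; for bounded [t] it is enough
    that [A] is bounded below, which follows from
    [x = T t x - (T t x - x)] at one large time [t]. *)
Lemma generator_decay (alpha : R) : 0 < alpha -> polynomially_stable A T alpha ->
  exists2 C : R, 0 < C & forall (t : R) x, 0 <= t -> dom A x ->
    nrm (T t x) <= C * (1 + t) `^ (- alpha^-1) * nrm (app A x).
Proof.
move=> a0 [[_ T0] [K [t0 [K0 hK]]]]; set p := alpha^-1.
have p0 : 0 <= p by rewrite invr_ge0 ltW.
pose t1 := Num.max t0 1.
have t11 : 1 <= t1 by rewrite le_max lexx orbT.
have t10 : 0 < t1 by rewrite (lt_le_trans ltr01).
have large (t : R) x : t1 <= t -> dom A x ->
    nrm (T t x) <= K * t `^ (- p) * nrm (app A x).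
  move=> t1t Ax.
  have tt : 0 <= t by rewrite (le_trans (ltW t10)).
  have lT := semigroup_linear hT tt.
  have [Ax0|Ax0] := eqVneq (nrm (app A x)) 0.
    have -> : x = 0 by apply: generator_ker => //; apply: nrm_le0; rewrite Ax0.
    by rewrite (linear_zero lT) nrm0 mulr_ge0 ?mulr_ge0 ?nrm_ge0 ?powR_ge0 ?(ltW K0).
  have {}Ax0 : 0 < nrm (app A x) by rewrite lt0r Ax0 nrm_ge0.
  have [Az AzE] := generator_scale (nrm (app A x))^-1%:C Ax.
  rewrite -ler_pdivrMr// mulrC -[X in X * _]ger0_norm ?invr_ge0 ?nrm_ge0//.
  rewrite -nrmZ -(linear_scale lT) -lee_fin.
  apply: le_trans (hK t _); last by rewrite (le_trans _ t1t)// le_max lexx.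
  rewrite -[X in T t X](inverse_generator T0 Az) AzE.
  apply: (@opnorm_ge R X X (T t \o app (op_inv A))).
  by rewrite nrmZ ger0_norm ?invr_ge0 ?nrm_ge0// mulVf ?gt_eqF.
have below x : dom A x -> nrm x <= (K * t1 `^ (- p) + M * t1) * nrm (app A x).
  move=> Ax; rewrite -{1}(subKr (T t1 x) x) (le_trans (nrmB _ _))// mulrDl lerD//.
    exact: large.
  exact: (semigroup_increment hT hA M0 hM (ltW t10)).
set L := K * t1 `^ (- p) + M * t1 in below.
have L0 : 0 <= L by rewrite addr_ge0 ?mulr_ge0 ?powR_ge0 ?(ltW K0) ?(ltW t10).
(* The first summand serves for [t1 <= t], where [(1 + t) / 2 <= t], and the second
   for [t <= t1]. *)
pose C := K * 2 `^ p + M * L * (1 + t1) `^ p.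
have C0 : 0 < C by rewrite ltr_pwDl ?mulr_gt0 ?powR_gt0// !mulr_ge0 ?powR_ge0.
have Kp : K * 2 `^ p <= C by rewrite lerDl !mulr_ge0 ?powR_ge0.
have MLp : M * L * (1 + t1) `^ p <= C by rewrite lerDr mulr_ge0 ?powR_ge0 ?(ltW K0).
exists C => // t x tt Ax.
have [t1t|/ltW tt1] := leP t1 t.
  rewrite (le_trans (large _ _ t1t Ax))// ler_wpM2r ?nrm_ge0//.
  have : t `^ (- p) <= ((1 + t) / 2) `^ (- p).
    by apply: powR_anti => //; lra.
  rewrite powRM ?invr_ge0 ?addr_ge0// => tp.
  rewrite (le_trans (ler_wpM2l (ltW K0) tp))// mulrCA mulrC ler_wpM2r ?powR_ge0//.
  by rewrite (le_trans _ Kp)// ler_pM2l// -(powR_inv1 (ler0n _ 2)) -powRrM mulN1r opprK.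
rewrite (le_trans (hM _ tt))// (le_trans (ler_wpM2l M0 (below _ Ax)))//.
rewrite mulrA ler_wpM2r ?nrm_ge0// -ler_pdivrMr ?powR_gt0 ?ltr_wpDr//.
rewrite powRN invrK (le_trans _ MLp)// ler_wpM2l ?mulr_ge0//.
by rewrite ge0_ler_powR ?nnegrE ?addr_ge0 ?lerD2l// ltW.
Qed.

End Stable.

(** * Norms of Bochner integrals *)

(** The integral of a nonnegative function is the supremum of the integrals of the
    simple functions below it, and this is monotone also for functions that are not
    measurable, such as the error terms in [is_bochner_integral]. *)
Lemma ge0_lower_integral_le d (T : measurableType d) (R : realType)
    (mu : {measure set T -> \bar R}) (D E : set T) (f g : T -> \bar R) :
  D `<=` E -> (forall t, D t -> 0 <= f t)%E -> (forall t, E t -> 0 <= g t)%E ->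
  (forall t, D t -> f t <= g t)%E ->
  (\int[mu]_(t in D) f t <= \int[mu]_(t in E) g t)%E.
Proof.
move=> DE f0 g0 fg; rewrite !ge0_integralE//= ge_ereal_sup// => _ [h /= hf <-].
apply: ereal_sup_ubound; exists h => //= t; apply: le_trans (hf t) _.
rewrite !patchE; case: ifPn => [/set_mem Dt|_].
  by rewrite mem_set; [exact: fg|exact: DE].
by case: ifPn => // /set_mem /g0.
Qed.

Section BochnerNorm.
Context {R : realType} {X Y : normedModType R[i]} {L : X -> Y}.
Hypothesis lL : linear L.
Notation mu := (@lebesgue_measure R).

Lemma simple_fun_measurable (s : R -> X) (h : X -> R) : simple_fun s ->
  measurable_fun setT (fun t => h (s t)).
Proof.
move=> [sfin ms] _ B mB; rewrite setTI.
have -> : (fun t => h (s t)) @^-1` B = \bigcup_(x in range s `&` h @^-1` B) (s @^-1` [set x]).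
  apply/seteqP; split=> [t /= Bt|t [x [_ Bx] /= ->]//].
  by exists (s t) => //; split => //; exists t.
by apply: fin_bigcup_measurable => [|x _]; [exact: finite_setIl|exact: ms].
Qed.

Lemma simple_integral_norm_le (D : set R) (s : R -> X) : measurable D ->
  simple_integrable D s ->
  ((nrm (L (simple_integral D s)))%:E <= \int[mu]_(t in D) (nrm (L (s t)))%:E)%E.
Proof.
move=> mD [[sfin ms] sint].
rewrite /simple_integral -(@fsbig_widen _ _ _ _ (range s))//=; last first.
  by move=> x [_ /= xs]; rewrite preimage10// setI0 measure0 /= scale0r.
rewrite fsbig_finite//= (linear_bigsum lL).
set r : seq X := (X in \sum_(_ <- X) _).
have -> : (\int[mu]_(t in D) (nrm (L (s t)))%:E =
    \int[mu]_(t in D) (\sum_(x <- r) (nrm (L x))%:E * (\1_(s @^-1` [set x]) t)%:E))%E.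
  apply: eq_integral => t _.
  rewrite (bigD1_seq (s t)) ?fset_uniq//=; last first.
    by have : s t \in fset_set (range s) by rewrite in_fset_set// mem_set//; exists t.
  rewrite indicE mem_set//= mule1 big1 ?adde0// => x xst.
  by rewrite indicE memNset ?mule0//= => stx; rewrite stx eqxx in xst.
rewrite ge0_integral_sum//; first last.
- by move=> x t _; rewrite mule_ge0// lee_fin nrm_ge0.
- move=> x; apply: measurable_funeM; apply/measurable_EFinP.
  by apply: measurable_funTS; apply: measurable_indic; exact: ms.
have -> : (\sum_(x <- r) \int[mu]_(t in D) ((nrm (L x))%:E * (\1_(s @^-1` [set x]) t)%:E) =
    \sum_(x <- r) (nrm (L ((fine (mu (D `&` s @^-1` [set x])))%:C *: x)))%:E)%E.
  apply: eq_bigr => x _.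
  rewrite ge0_integralZl_EFin ?nrm_ge0//; last first.
    by apply/measurable_EFinP; apply: measurable_funTS; apply: measurable_indic; exact: ms.
  rewrite (@integral_indic _ (measurableTypeR R) R mu D mD _ (ms x)).
  rewrite (setIC _ D).
  set m := mu _.
  have [->|x0] := eqVneq x 0.
    by rewrite scaler0 (linear_zero lL) nrm0 mul0e.
  have m0 : (0 <= m)%E by exact: measure_ge0.
  have mfin : m \is a fin_num by rewrite ge0_fin_numE// /m sint.
  rewrite (linear_scale lL) nrmZ ger0_norm ?fine_ge0//.
  by rewrite EFinM fineK// muleC.
by rewrite sumEFin lee_fin nrm_sum.
Qed.

(** If the simple functions [s n] approximate [f], the positive part of
    [nrm (L (s n t)) - g t] is at most [M * nrm (f t - s n t)] almost everywhere,
    so the integral of [nrm (L (s n t))] exceeds that of [g] by a quantity tending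
    to [0]. Putting [L] inside the estimate avoids computing the Bochner integral
    of the composition of [L] and [f]. *)
Lemma bochner_norm_le (D : set R) (f : R -> X) (y : X) (M K : R) (g : R -> R) :
  (forall x, nrm (L x) <= M * nrm x) -> 0 <= M -> measurable D ->
  measurable_fun D g -> (forall t, D t -> 0 <= g t) ->
  {ae mu, forall t, D t -> nrm (L (f t)) <= g t} ->
  (\int[mu]_(t in D) (g t)%:E <= K%:E)%E ->
  is_bochner_integral D f y -> nrm (L y) <= K.
Proof.
move=> LM M0 mD mg g0 fg gK [_ [s [sint s0 sy]]].
pose M' := M + 1.
have M'0 : 0 < M' by rewrite ltr_wpDl.
have LM' x : nrm (L x) <= M' * nrm x.
  by rewrite (le_trans (LM x))// ler_wpM2r ?nrm_ge0// lerDl.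
apply/ler_addgt0Pr => e e0.
(* Half of [e] pays for the integral error, half for the error in [y]. *)
pose d := e / (2 * M').
have d0 : 0 < d by rewrite divr_gt0// mulr_gt0.
have dE : M' * d + M' * d = e by rewrite /d; field; rewrite gt_eqF.
have s0d : \forall n \near \oo, (\int[mu]_(t in D) (nrm (f t - s n t))%:E < d%:E)%E.
  by apply: (s0 (fun u => (u < d%:E)%E)); apply: open_ereal_lt'; rewrite lte_fin.
have syd : \forall n \near \oo, nrm (simple_integral D (s n) - y) < d.
  by move/cvg_nrmP : sy => /(_ d d0).
near \oo => n.
have hs0 : (\int[mu]_(t in D) (nrm (f t - s n t))%:E < d%:E)%E by near: n.
have hsy : nrm (simple_integral D (s n) - y) < d by near: n.
have [sn _] := sint n.
have mLs : measurable_fun D (fun t => nrm (L (s n t))).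
  by apply: measurable_funTS; exact: (simple_fun_measurable (fun x => nrm (L x))).
pose h t := Num.max (nrm (L (s n t)) - g t) 0 / M'.
have h0 t : 0 <= h t by rewrite divr_ge0 ?(ltW M'0)// le_max lexx orbT.
have mh : measurable_fun D h.
  apply: measurable_funM => //; apply: measurable_maxr => //.
  exact: measurable_funB.
have hd : (\int[mu]_(t in D) (h t)%:E <= d%:E)%E.
  apply: le_trans (ltW hs0).
  have [N [mN N0 fgN]] := fg.
  rewrite (@ge0_negligible_integral _ (measurableTypeR R) R mu D N)//; last 2 first.
  - by apply/measurable_EFinP.
  - by move=> t _; rewrite lee_fin.
  apply: ge0_lower_integral_le => [t []//|t _|t _|t [Dt Nt]].
  - by rewrite lee_fin.
  - by rewrite lee_fin nrm_ge0.
  have gt : nrm (L (f t)) <= g t.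
    by apply: contrapT => fgt; apply: Nt; apply: fgN => /= /(_ Dt).
  rewrite lee_fin ler_pdivrMr// ge_max; apply/andP; split; last first.
    by rewrite mulr_ge0 ?nrm_ge0 ?(ltW M'0).
  rewrite lerBlDr -(nrmN (f t - s n t)) opprB mulrC.
  rewrite -{1}(subrK (f t) (s n t)) (linear_add lL) (le_trans (nrmD _ _))//.
  by rewrite lerD.
have Lsn : nrm (L (simple_integral D (s n))) <= K + M' * d.
  rewrite -lee_fin (le_trans (simple_integral_norm_le mD (sint n)))// EFinD EFinM.
  apply: (@le_trans _ _ (\int[mu]_(t in D) ((g t)%:E + M'%:E * (h t)%:E))%E).
    apply: ge0_le_integral => //.
    - by move=> t _; rewrite lee_fin nrm_ge0.
    - by apply/measurable_EFinP.
    - apply: emeasurable_funD; first exact/measurable_EFinP.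
      by apply: measurable_funeM; exact/measurable_EFinP.
    move=> t _; rewrite -EFinM -EFinD lee_fin /h mulrC divfK ?gt_eqF//.
    by rewrite -lerBlDl le_max lexx.
  rewrite ge0_integralD//; first last.
  - by apply: measurable_funeM; exact/measurable_EFinP.
  - by move=> t _; rewrite -EFinM lee_fin mulr_ge0// ltW.
  - exact/measurable_EFinP.
  rewrite ge0_integralZl_EFin ?(ltW M'0)//; first last.
  - exact/measurable_EFinP.
  - by move=> t _; rewrite lee_fin.
  by rewrite leeD// lee_pmul2l.
rewrite -dE -{1}(subKr (simple_integral D (s n)) y) (linear_sub lL).
rewrite (le_trans (nrmB _ _))// addrA lerD// (le_trans (LM' _))//.
by rewrite ler_wpM2l ?ltW// ltW.
Unshelve. all: by end_near. Qed.

End BochnerNorm.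

(** * Integrals of powers *)

Section PowerIntegrals.
Context {R : realType}.
Notation mu := (@lebesgue_measure R).

Lemma integral_segment_FTC (f F : R -> R) (a b : R) : a <= b ->
  (forall x, a <= x <= b -> {for x, continuous f}) ->
  (forall x, a <= x <= b -> is_derive x 1 F (f x)) ->
  (\int[mu]_(x in `[a, b]) (f x)%:E = (F b - F a)%:E)%E.
Proof.
rewrite le_eqVlt => /predU1P[<- _ _|ab cf dF].
  by rewrite set_itv1 integral_set1 subrr.
have cF x : a <= x <= b -> {for x, continuous F}.
  move=> xab; apply/differentiable_continuous/derivable1_diffP.
  by have [] := dF _ xab.
rewrite EFinB; apply: continuous_FTC2 => //.
- apply: continuous_in_subspaceT => x; rewrite inE /= in_itv /= => xab.
  exact: cf.
- split.
  + move=> x; rewrite in_itv /= => /andP[ax xb].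
    have xab : a <= x <= b by rewrite !ltW.
    by have [] := dF _ xab.
  + by apply: cvg_at_right_filter; apply: cF; rewrite lexx ltW.
  + by apply: cvg_at_left_filter; apply: cF; rewrite lexx ltW.
- move=> x; rewrite in_itv /= => /andP[ax xb].
  rewrite derive1E; have xab : a <= x <= b by rewrite !ltW.
  by have [_] := dF _ xab.
Qed.

Lemma powR_continuous (e x : R) : 0 < x -> {for x, continuous (fun s => s `^ e)}.
Proof.
move=> x0; apply/differentiable_continuous/derivable1_diffP.
by have [] := is_derive1_powR e x0.
Qed.

Lemma integral_powR (e a b : R) : e != 0 -> 0 < a -> a <= b ->
  (\int[mu]_(s in `[a, b]) (s `^ (e - 1))%:E = ((b `^ e - a `^ e) / e)%:E)%E.
Proof.
move=> e0 a0 ab.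
have -> : (b `^ e - a `^ e) / e = e^-1 * b `^ e - e^-1 * a `^ e by rewrite -mulrBr mulrC.
apply: (@integral_segment_FTC _ (fun s => e^-1 * s `^ e)) => //.
- by move=> x /andP[ax _]; apply: powR_continuous; exact: lt_le_trans ax.
- move=> x /andP[ax _]; have x0 : 0 < x by exact: lt_le_trans ax.
  have dx := is_derive1_powR e x0.
  rewrite (_ : (fun s => _) = e^-1 *: (fun s => s `^ e)); last exact/funext.
  by apply: is_derive_eq; rewrite /GRing.scale /= mulKf.
Qed.

(** A bound on all segments of an increasing family passes to the union by
    monotone convergence. *)
Lemma integral_bigcup_segment_le (f : R -> R) (p q : nat -> R) (D : set R) (K : R) :
  (forall n, p n.+1 <= p n) -> (forall n, q n <= q n.+1) ->
  D = \bigcup_n `[p n, q n]%classic ->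
  measurable_fun setT f -> (forall x, 0 <= f x) ->
  (forall n, \int[mu]_(x in `[p n, q n]) (f x)%:E <= K%:E)%E ->
  (\int[mu]_(x in D) (f x)%:E <= K%:E)%E.
Proof.
move=> pd qi -> mf f0 fK.
pose I n : set (measurableTypeR R) := `[p n, q n]%classic.
have ndI : nondecreasing_seq I.
  apply/nondecreasing_seqP => n; apply/subsetPset => x; rewrite /I /= !in_itv /=.
  by move=> /andP[px xq]; rewrite (le_trans (pd n))// (le_trans xq).
have cvgI : (\int[mu]_(x in I n) (f x)%:E)%E @[n --> \oo] -->
    (\int[mu]_(x in \bigcup_n I n) (f x)%:E)%E.
  apply: (@ge0_nondecreasing_set_cvg_integral _ (measurableTypeR R)) => //.
  - by move=> n; exact: measurable_itv.
  - by move=> n; apply/measurable_EFinP; exact: measurable_funTS.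
  - by move=> n x _; rewrite lee_fin.
rewrite -(cvg_lim _ cvgI)//; apply: lime_le; first by apply/cvg_ex; eexists; exact: cvgI.
exact: nearW.
Qed.

Lemma integral_powR_0 (e b : R) : 0 < e -> 0 < b ->
  (\int[mu]_(s in `]0%R, b]) (s `^ (e - 1))%:E <= (b `^ e / e)%:E)%E.
Proof.
move=> e0 b0.
apply: (@integral_bigcup_segment_le _ (fun n => b / n.+1%:R) (fun=> b)) => //.
- by move=> n; rewrite ler_pM2l// lef_pV2 ?posrE// ler_nat.
- apply/seteqP; split => x /=.
    rewrite in_itv /= => /andP[x0 xb]; exists (Num.truncn (b / x)) => //=.
    rewrite in_itv /= xb andbT ler_pdivrMr// mulrC -ler_pdivrMr//.
    by rewrite ltW// truncnS_gt.
  move=> [n _ /=]; rewrite !in_itv /= => /andP[bx ->]; rewrite andbT.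
  by rewrite (lt_le_trans _ bx)// divr_gt0.
- by move=> x; exact: powR_ge0.
- move=> n; rewrite integral_powR ?gt_eqF ?divr_gt0//.
    by rewrite lee_fin ler_pM2r ?invr_gt0// gerBl powR_ge0.
  by rewrite ler_pdivrMr// ler_peMr ?(ltW b0)// ler1n.
Qed.

Lemma integral_powR_pinfty (e a : R) : 0 < e -> 0 < a ->
  (\int[mu]_(s in `[a, +oo[) (s `^ (- e - 1))%:E <= (a `^ (- e) / e)%:E)%E.
Proof.
move=> e0 a0.
apply: (@integral_bigcup_segment_le _ (fun=> a) (fun n => a + n%:R)) => //.
- by move=> n; rewrite lerD2l ler_nat.
- exact: itv_bndy_bigcup_BRight.
- by move=> x; exact: powR_ge0.
- move=> n; rewrite integral_powR ?oppr_eq0 ?gt_eqF ?lerDl//.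
  by rewrite lee_fin invrN mulrN -mulNr opprB ler_pM2r ?invr_gt0// gerBl powR_ge0.
Qed.

End PowerIntegrals.

(** * Decay on the ranges of negative fractional powers *)

(** A function that is not Bochner integrable has integral [0], and [0 <= K]
    because [g] is nonnegative. *)
Lemma bochner_integral_norm_le {R : realType} {X Y : normedModType R[i]}
    {L : X -> Y} (lL : linear L) (D : set R) (f : R -> X) (M K : R) (g : R -> R) :
  (forall x, nrm (L x) <= M * nrm x) -> 0 <= M -> measurable D ->
  measurable_fun D g -> (forall t, D t -> 0 <= g t) ->
  {ae @lebesgue_measure R, forall t, D t -> nrm (L (f t)) <= g t} ->
  (\int[@lebesgue_measure R]_(t in D) (g t)%:E <= K%:E)%E ->
  nrm (L (bochner_integral D f)) <= K.
Proof.
move=> LM M0 mD mg g0 fg gK.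
have K0 : 0 <= K.
  by rewrite -lee_fin; apply: le_trans gK; apply: integral_ge0 => t Dt; rewrite lee_fin g0.
rewrite /bochner_integral; case: xgetP => [y _ fy|_].
  exact: (bochner_norm_le lL LM M0 mD mg g0 fg gK fy).
by rewrite (linear_zero lL) nrm0.
Qed.

Section FractionalDecay.
Context {R : realType} {X : normedModType R[i]} {A : partial_op X}
  {T : R -> X -> X} {M : R}.
Hypothesis hT : C0_semigroup T.
Hypothesis hA : is_generator A T.
Hypothesis M0 : 0 <= M.
Hypothesis hM : forall (t : R) (x : X), 0 <= t -> nrm (T t x) <= M * nrm x.
Notation mu := (@lebesgue_measure R).

Lemma resolventP (lam : R[i]) x :
  (dom A (resolvent A lam x) /\ lam *: resolvent A lam x - app A (resolvent A lam x) = x)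
  \/ resolvent A lam x = 0.
Proof.
by rewrite /resolvent /=; case: xgetP => [y _ [Ay yx]|_]; [left|right].
Qed.

Lemma resolvent_norm_le (s : R) x : 0 < s ->
  nrm (resolvent A s%:C x) <= M * nrm x / s.
Proof.
move=> s0; rewrite ler_pdivlMr// mulrC.
case: (resolventP s%:C x) => [[Ar rE]|->].
  by rewrite -{2}rE (resolvent_bound hT hA M0 hM s0 Ar).
by rewrite nrm0 mulr0 mulr_ge0// nrm_ge0.
Qed.

(** [A (s - A)^-1 x = s (s - A)^-1 x - x] is bounded uniformly in [s] by
    [resolvent_norm_le], so the decay of [T t] on the domain of [A] carries over to
    [(s - A)^-1 x] with a constant that stays bounded as [s] tends to [0]. *)
Lemma semigroup_resolvent_le (t a s : R) x : 0 <= t -> 0 <= a -> 0 < s ->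
  (forall z, dom A z -> nrm (T t z) <= a * nrm (app A z)) ->
  nrm (T t (resolvent A s%:C x)) <= a * ((M + 1) * nrm x).
Proof.
move=> t0 a0 s0 ha; case: (resolventP s%:C x) => [[Ar rE]|->]; last first.
  by rewrite (linear_zero (semigroup_linear hT t0)) nrm0 !mulr_ge0 ?nrm_ge0// addr_ge0.
rewrite (le_trans (ha _ Ar))// ler_wpM2l//.
have -> : app A (resolvent A s%:C x) = s%:C *: resolvent A s%:C x - x.
  by rewrite -{3}rE opprB addrC subrK.
rewrite (le_trans (nrmB _ _))// mulrDl mul1r lerD2r nrmZ gtr0_norm//.
by rewrite mulrC -ler_pdivlMr// resolvent_norm_le.
Qed.

(** Under [T t] the integrand has norm at most [a * (M + 1) * s ^ (- gam) * nrm x]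
    and at most [M ^ 2 * s ^ (- gam - 1) * nrm x]. The first bound is integrable
    near [0] and the second at infinity; cutting the integral at [s = a^-1] balances
    them and yields the interpolated rate [a ^ gam]. *)
Lemma neg_frac_power_lt1_decay (gam : R) : 0 < gam -> gam < 1 ->
  exists2 C : R, 0 <= C & forall (t a : R) x, 0 <= t -> 0 < a ->
    (forall z, dom A z -> nrm (T t z) <= a * nrm (app A z)) ->
    nrm (T t (neg_frac_power_lt1 A gam x)) <= C * a `^ gam * nrm x.
Proof.
move=> g0 g1.
pose k := (M + 1) / (1 - gam) + M ^+ 2 / gam.
exists (`|sin (pi * gam) / pi| * k).
  by rewrite mulr_ge0// addr_ge0// divr_ge0 ?(ltW g0) ?subr_ge0 ?(ltW g1) ?exprn_ge0 ?addr_ge0.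
move=> t a x t0 a0 ha; have lT := semigroup_linear hT t0.
rewrite /neg_frac_power_lt1 (linear_scale lT) nrmZ -!mulrA ler_wpM2l//.
pose P := a * ((M + 1) * nrm x); pose Q := M * (M * nrm x).
have P0 : 0 <= P by rewrite !mulr_ge0 ?nrm_ge0 ?addr_ge0 ?(ltW a0).
have Q0 : 0 <= Q by rewrite !mulr_ge0 ?nrm_ge0.
pose g s := if s <= a^-1 then P * s `^ ((1 - gam) - 1) else Q * s `^ (- gam - 1).
have ge0 s : 0 <= g s by rewrite /g; case: ifP => _; rewrite mulr_ge0// powR_ge0.
have mg : measurable_fun setT g.
  apply: measurable_fun_ifT; first exact: measurable_fun_ler.
    by apply: measurable_funM => //; exact: measurable_powR.
  by apply: measurable_funM => //; exact: measurable_powR.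
apply: (bochner_integral_norm_le lT (fun x => hM x t0) M0 (g := g)) => //.
- exact: measurable_funTS.
- apply: aeW => s /=; rewrite in_itv /= andbT => s0.
  rewrite (linear_scale lT) nrmZ ger0_norm ?powR_ge0// /g; case: ifP => _.
    by rewrite addrAC subrr sub0r mulrC ler_wpM2r ?powR_ge0// semigroup_resolvent_le// ltW.
  have -> : s `^ (- gam - 1) = s `^ (- gam) * s^-1.
    by rewrite powRD ?(gt_eqF s0) ?implybT// powR_inv1 ?(ltW s0).
  rewrite mulrCA ler_wpM2l ?powR_ge0//.
  by rewrite (le_trans (hM _ t0))// -mulrA ler_wpM2l// resolvent_norm_le.
- have i0 : 0 < a^-1 by rewrite invr_gt0.
  have -> : `]0%R, +oo[%classic = (`]0%R, a^-1] `|` `]a^-1, +oo[)%classic.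
    by rewrite -itv_bndbnd_setU// bnd_simp// ltW.
  rewrite ge0_integral_setU//=; last first.
  + apply/disj_setPS => s [] /=; rewrite !in_itv /= andbT => /andP[_ sa].
    by rewrite ltNge sa.
  + by move=> s _; rewrite lee_fin.
  + by apply/measurable_EFinP; exact: measurable_funTS.
  have -> : k * (a `^ gam * nrm x) = P * (a^-1 `^ (1 - gam) / (1 - gam)) +
      Q * (a^-1 `^ (- gam) / gam).
    have aN e : a^-1 `^ e = a `^ (- e) by rewrite -(powR_inv1 (ltW a0)) -powRrM mulN1r.
    rewrite !aN opprB opprK powRD ?(gt_eqF a0) ?implybT// powR_inv1 ?(ltW a0)// /k /P /Q.
    by field; rewrite !gt_eqF ?subr_gt0.
  rewrite EFinD leeD//.
    apply: (@le_trans _ _ (\int[mu]_(s in `]0%R, a^-1%R]) (P%:E * (s `^ ((1 - gam) - 1))%:E))%E).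
      apply: ge0_lower_integral_le => // s; rewrite /= in_itv /= => /andP[s0 sa].
      - by rewrite lee_fin.
      - by rewrite -EFinM lee_fin mulr_ge0 ?powR_ge0.
      - by rewrite /g sa -EFinM.
    rewrite ge0_integralZl_EFin//; first last.
    + by apply/measurable_EFinP; apply: measurable_funTS; exact: measurable_powR.
    + by move=> s _; rewrite lee_fin powR_ge0.
    rewrite (EFinM P) lee_pmul//; first by apply: integral_ge0 => s _; rewrite lee_fin powR_ge0.
    by apply: integral_powR_0; rewrite ?subr_gt0.
  apply: (@le_trans _ _ (\int[mu]_(s in `[a^-1%R, +oo[) (Q%:E * (s `^ (- gam - 1))%:E))%E).
    apply: ge0_lower_integral_le => s; rewrite /= !in_itv /= !andbT => sa.
    - exact: ltW.
    - by rewrite lee_fin.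
    - by rewrite -EFinM lee_fin mulr_ge0 ?powR_ge0.
    - by rewrite /g (leNgt s) sa /= -EFinM.
  rewrite ge0_integralZl_EFin//; first last.
  + by apply/measurable_EFinP; apply: measurable_funTS; exact: measurable_powR.
  + by move=> s _; rewrite lee_fin powR_ge0.
  rewrite (EFinM Q) lee_pmul//; first by apply: integral_ge0 => s _; rewrite lee_fin powR_ge0.
  exact: integral_powR_pinfty.
Qed.

End FractionalDecay.
Section NegFracPowerDecay.
Context {R : realType} {X : normedModType R[i]} {A : partial_op X}
  {T : R -> X -> X} {M : R}.
Hypothesis hT : C0_semigroup T.
Hypothesis hA : is_generator A T.
Hypothesis M0 : 0 <= M.
Hypothesis hM : forall (t : R) (x : X), 0 <= t -> nrm (T t x) <= M * nrm x.

(** Each factor [(- A)^-1] uses up one time interval of length [t], and [T] commutes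
    with the remaining factors. *)
Lemma iter_resolvent0_decay (t s a : R) n v : 0 <= t -> 0 <= s -> 0 <= a ->
  (forall z, dom A z -> nrm (T t z) <= a * nrm (app A z)) ->
  nrm (T (n%:R * t + s) (iter n (resolvent A 0) v)) <= a ^+ n * nrm (T s v).
Proof.
move=> t0 s0 a0 ha; elim: n => [|n IH]; first by rewrite mul0r add0r expr0 mul1r.
have nts0 : 0 <= n%:R * t + s by rewrite addr_ge0// mulr_ge0.
have [_ _ TD _] := hT.
rewrite -natr1 mulrDl mul1r addrAC addrC TD//=.
set w := iter n _ v in IH *.
case: (@resolventP _ _ A 0 w) => [[Ar rE]|->]; last first.
  rewrite !(linear_zero (semigroup_linear hT _))// nrm0 mulr_ge0 ?nrm_ge0//.
  by rewrite exprn_ge0.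
have [AT ATE] := generator_semigroup hT hA hM nts0 Ar.
rewrite (le_trans (ha _ AT))// ATE exprS -mulrA ler_wpM2l//.
have -> : app A (resolvent A 0 w) = - w by rewrite -{2}rE scale0r sub0r opprK.
by rewrite -scaleN1r (linear_scale (semigroup_linear hT nts0)) scaleN1r nrmN.
Qed.

(** Writing [beta = n + gam], the time [t] is shared equally between the [n]
    factors [(- A)^-1] and the fractional factor. *)
Lemma neg_frac_power_decay (C0 p beta : R) : 0 < C0 -> 0 <= p -> 0 <= beta ->
  (forall (t : R) z, 0 <= t -> dom A z ->
    nrm (T t z) <= C0 * (1 + t) `^ (- p) * nrm (app A z)) ->
  exists2 C : R, 0 <= C & forall (t : R) x, 0 <= t ->
    nrm (T t (neg_frac_power A beta x)) <= C * (1 + t) `^ (- (beta * p)) * nrm x.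
Proof.
move=> C00 p0 b0 hdec.
pose n := Num.truncn beta; pose gam := beta - n%:R.
have /andP[nb bn] := truncn_itv b0.
have gam0 : 0 <= gam by rewrite subr_ge0.
have gam1 : gam < 1 by rewrite ltrBlDl natr1.
have [C C_ge0 hC] : exists2 C : R, 0 <= C & forall (t a : R) x, 0 <= t -> 0 < a ->
    (forall z, dom A z -> nrm (T t z) <= a * nrm (app A z)) ->
    nrm (T t (if gam == 0 then x else neg_frac_power_lt1 A gam x)) <= C * a `^ gam * nrm x.
  have [->|gam_neq0] := eqVneq gam 0.
    by exists M => // t a x t0 a0 _; rewrite powRr0 mulr1 hM.
  have {}gam0 : 0 < gam by rewrite lt0r gam_neq0.
  exact: (neg_frac_power_lt1_decay hT hA M0 hM gam0 gam1).
pose q := beta * p.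
have q0 : 0 <= q by rewrite mulr_ge0.
exists (C * (C0 `^ beta * n.+1%:R `^ q)).
  by rewrite !mulr_ge0 ?powR_ge0.
move=> t x t0.
pose t' := t / n.+1%:R; pose a := C0 * (1 + t') `^ (- p).
have t'0 : 0 <= t' by rewrite divr_ge0.
have t'1 : 0 < 1 + t' by rewrite ltr_wpDr.
have a0 : 0 < a by rewrite mulr_gt0// powR_gt0.
have ha z : dom A z -> nrm (T t' z) <= a * nrm (app A z) by exact: hdec.
have tE : t = n%:R * t' + t' by rewrite -{2}(mul1r t') -mulrDl natr1 mulrC divfK// pnatr_eq0.
rewrite /neg_frac_power -/n -/gam {1}tE.
rewrite (le_trans (iter_resolvent0_decay _ _ t'0 t'0 (ltW a0) ha))//.
rewrite (le_trans (ler_wpM2l (exprn_ge0 _ (ltW a0)) (hC _ _ x t'0 a0 ha)))//.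
rewrite [leLHS]mulrA ler_wpM2r ?nrm_ge0// [leLHS]mulrCA -!mulrA ler_wpM2l//.
have -> : a ^+ n * a `^ gam = a `^ beta.
  rewrite -powR_mulrn ?(ltW a0)// -powRD ?(gt_eqF a0) ?implybT//.
  by rewrite /gam addrC subrK.
rewrite powRM ?(ltW C00) ?powR_ge0// ler_wpM2l ?powR_ge0// -powRrM.
have -> : - p * beta = - q by rewrite mulNr mulrC.
have nq : n.+1%:R `^ q * (1 + t) `^ (- q) = ((1 + t) / n.+1%:R) `^ (- q).
  by rewrite powRM ?addr_ge0// mulrC -(powR_inv1 (ler0n _ _)) -powRrM mulN1r opprK.
rewrite nq; apply: powR_anti => //; first by rewrite divr_gt0// ltr_wpDr.
by rewrite ler_pdivrMr// mulrDl mul1r /t' divfK ?pnatr_eq0// lerD2r ler1n.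
Qed.

End NegFracPowerDecay.

(** * The forced response *)

Section ForcedResponse.
Context {R : realType} {X U : completeNormedModType R[i]} {A : partial_op X}
  {T : R -> X -> X} {M : R} {B : U -> X}.
Hypothesis hT : C0_semigroup T.
Hypothesis M0 : 0 <= M.
Hypothesis hM : forall (t : R) (x : X), 0 <= t -> nrm (T t x) <= M * nrm x.
Hypothesis hB : bounded_linear B.

(** A rate that holds for each [u] separately becomes uniform in [u] by applying
    [uniform_boundedness] to the operators [(1 + t) ^ d * T t B], [0 <= t]. *)
Lemma input_decay (d : R) : 0 <= d ->
  (forall u, exists C : R, forall t : R, 0 <= t ->
     nrm (T t (B u)) <= C * (1 + t) `^ (- d)) ->
  exists2 C : R, 0 < C & forall (t : R) u, 0 <= t ->
    nrm (T t (B u)) <= C * (1 + t) `^ (- d) * nrm u.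
Proof.
move=> d0 hp; have [lB [MB hMB]] := hB.
pose F (t : {t : R | 0 <= t}) (u : U) : X := ((1 + sval t) `^ d)%:C *: T (sval t) (B u).
have t1 (t : R) : 0 <= t -> 0 < 1 + t by move=> t0; rewrite ltr_wpDr.
have [C hC] : exists C : R, forall t u, nrm (F t u) <= C * nrm u.
  apply: uniform_boundedness => [[t t0]|u].
    have lT := semigroup_linear hT t0; rewrite /F /=; split.
      move=> a u v; rewrite lB lT scalerDr !scalerA [a * _]mulrC //.
    exists ((1 + t) `^ d * (M * MB)) => u.
    rewrite nrmZ ger0_norm ?powR_ge0// -mulrA ler_wpM2l ?powR_ge0//.
    by rewrite (le_trans (hM _ t0))// -mulrA ler_wpM2l.
  have [C hC] := hp u; exists C => -[t t0]; rewrite /F /=.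
  rewrite nrmZ ger0_norm ?powR_ge0// mulrC -ler_pdivlMr ?powR_gt0 ?t1//.
  by rewrite -powRN hC.
exists (`|C| + 1); first by rewrite ltr_wpDl.
move=> t u t0; have := hC (exist _ t t0) u.
rewrite /F /= nrmZ ger0_norm ?powR_ge0// mulrC -ler_pdivlMr ?powR_gt0 ?t1//.
rewrite -powRN => /le_trans; apply.
rewrite mulrAC ler_wpM2r ?nrm_ge0// ler_wpM2r ?powR_ge0//.
by rewrite (le_trans (ler_norm C))// lerDl.
Qed.

(** The essential supremum is an infimum over almost everywhere upper bounds, so
    its sign depends on the whole line not being negligible. *)
Lemma esssup_norm_ge0 (u : R -> U) : (0 <= esssup_norm u)%E.
Proof.
apply: ess_sup_gee; last first.
  by apply: aeW => t /=; case: ifP => // _; rewrite lee_fin nrm_ge0.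
apply: (@lt_le_trans _ _ (@lebesgue_measure R `[0, 1])).
  by rewrite lebesgue_measure_itv /= lte_fin ltr01 oppr0 adde0 lte_fin.
by apply: le_measure => //; rewrite inE.
Qed.

Lemma Linfty_norm_ae (u : R -> U) : Linfty u ->
  {ae @lebesgue_measure R, forall t, 0 <= t -> nrm (u t) <= Linfty_norm u}.
Proof.
move=> [_ ufin].
have [N [mN N0 ltN]] := ess_sup_ge (@lebesgue_measure R)
  (fun t => if 0 <= t then (nrm (u t))%:E else 0%E).
exists N; split => // t /= ut; apply: ltN => /= uess; apply: ut => t0.
move: uess; rewrite t0 -/(esssup_norm u) -lee_fin fineK//.
by rewrite ge0_fin_numE// esssup_norm_ge0.
Qed.

Lemma forced_response_le (C d : R) : 0 <= C -> 1 < d ->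
  (forall (t : R) u, 0 <= t -> nrm (T t (B u)) <= C * (1 + t) `^ (- d) * nrm u) ->
  forall (t : R) u, 0 <= t -> Linfty u ->
    nrm (bochner_integral `[0, t] (fun s => T (t - s) (B (u s))))
      <= C / (d - 1) * Linfty_norm u.
Proof.
move=> C0 d1 hC t u t0 hu; set N := Linfty_norm u.
have N0 : 0 <= N by apply: fine_ge0; exact: esssup_norm_ge0.
(* The integral of this majorant over [0, t] stays bounded because [1 < d]. *)
pose g s := C * N * (1 + t - s) `^ (- d).
have idl : linear (id : X -> X) by move=> a x y.
have mg : measurable_fun setT g.
  apply: measurable_funM => //.
  apply: measurableT_comp (measurable_powR _) _.
  exact: measurable_funB.
apply: (@bochner_integral_norm_le _ _ _ id idl _ _ 1 _ g) => //.
- by move=> x; rewrite mul1r.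
- exact: measurable_funTS.
- by move=> s _; rewrite !mulr_ge0 ?powR_ge0.
- have [Z [mZ Z0 uZ]] := Linfty_norm_ae hu; exists Z; split => // s /= gs.
  apply: uZ => /= us; apply: gs; rewrite in_itv /= => /andP[s0 st].
  rewrite (le_trans (hC _ _ _))// ?subr_ge0// addrA /g mulrAC ler_wpM2r ?powR_ge0//.
  by rewrite ler_wpM2l// us.
have d10 : 0 < d - 1 by rewrite subr_gt0.
pose F s := C * N / (d - 1) * (1 + t - s) `^ (1 - d).
rewrite (_ : (\int[_]_(s in _) _)%E = (F t - F 0)%:E).
  rewrite /F addrK powR1 mulr1 lee_fin mulrAC gerBl.
  by rewrite !mulr_ge0 ?powR_ge0 ?invr_ge0 ?(ltW d10).
have pos x : 0 <= x <= t -> 0 < 1 + t - x.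
  by move=> /andP[_ xt]; rewrite -addrA ltr_wpDr ?subr_ge0.
apply: integral_segment_FTC => // x xt.
- apply: continuousM; first exact: cst_continuous.
  apply: (@continuous_comp _ _ _ (fun s => 1 + t - s) (fun s => s `^ (- d))).
    by apply: continuousB; [exact: cst_continuous|].
  exact: powR_continuous (pos _ xt).
- have dx := is_derive1_powR (1 - d) (pos _ xt).
  have dt : is_derive x 1 (fun s : R => 1 + t - s) (- 1).
    rewrite (_ : (fun s => _) = cst (1 + t) - id); last exact/funext.
    by apply: is_derive_eq; rewrite sub0r.
  have dc := @is_derive1_comp R (fun s => s `^ (1 - d)) (fun s => 1 + t - s) x _ _ dx dt.
  rewrite (_ : F = C * N / (d - 1) *:
    ((fun s => s `^ (1 - d)) \o (fun s => 1 + t - s))); last exact/funext.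
  apply: is_derive_eq.
  rewrite /GRing.scale /= /g.
  have -> : 1 - d - 1 = - d by rewrite addrAC subrr sub0r.
  by field; rewrite gt_eqF.
Qed.

End ForcedResponse.

(** * Comparison functions *)

Lemma classKinf_scale {R : realType} (c : R) : 0 < c -> classKinf (fun r : R => c * r).
Proof.
move=> c0; split; first split.
- by apply: continuous_subspaceT => r; apply: continuousM; [exact: cst_continuous|].
- by move=> r r0; rewrite mulr_ge0// ltW.
- by move=> r s r0 rs; rewrite ltr_pM2l.
- by rewrite mulr0.
move=> K; exists (`|K| / c + 1); split; first by rewrite addr_ge0// divr_ge0// ltW.
by rewrite mulrDr mulrCA divff ?gt_eqF// !mulr1 (le_lt_trans (ler_norm K))// ltrDl.
Qed.

Lemma powR_cvg0 {R : realType} (p : R) : 0 < p ->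
  (1 + t) `^ (- p) @[t --> +oo] --> (0 : R).
Proof.
move=> p0; apply/cvgrPdist_lt => e e0; near=> t.
have t0 : 0 < t by near: t; exact: nbhs_pinfty_gt.
rewrite sub0r normrN ger0_norm ?powR_ge0// powRN invf_plt ?posrE ?powR_gt0 ?addr_gt0//.
have : e^-1 `^ p^-1 < 1 + t.
  rewrite (@lt_trans _ _ t) ?ltrDr//; near: t; exact: nbhs_pinfty_gt.
move=> /(@gt0_ltr_powR _ p p0).
rewrite !nnegrE powR_ge0 addr_ge0 ?(ltW t0)// => /(_ isT isT).
by rewrite -powRrM mulVf ?gt_eqF// powRr1// invr_ge0 ltW.
Unshelve. all: by end_near. Qed.

Lemma classKL_powR {R : realType} (c p : R) : 0 < c -> 0 < p ->
  classKL (fun r t : R => c * r * (1 + t) `^ (- p)).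
Proof.
move=> c0 p0.
have pc (t : R) : 0 <= t -> {for t, continuous (fun s : R => (1 + s) `^ (- p))}.
  move=> t0; apply: (@continuous_comp _ _ _ (fun s : R => 1 + s) (fun s : R => s `^ (- p))).
    by apply: continuousD; [exact: cst_continuous|].
  by apply: powR_continuous; rewrite ltr_wpDr.
split.
- apply: continuous_in_subspaceT => -[r t]; rewrite inE => -[/= r0 t0].
  rewrite /continuous_at; apply: cvgM; first by apply: cvgM; [exact: cvg_cst|exact: cvg_fst].
  apply: (@continuous_comp _ _ _ snd (fun s : R => (1 + s) `^ (- p))).
    exact: cvg_snd.
  exact: pc.
- move=> t t0.
  have [k k0 kE] : exists2 k : R, 0 < k & forall r : R, c * r * (1 + t) `^ (- p) = k * r.
    exists (c * (1 + t) `^ (- p)); first by rewrite mulr_gt0// powR_gt0// ltr_wpDr.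
    by move=> r; rewrite mulrAC.
  rewrite (_ : (fun r => _) = (fun r => k * r)); last exact/funext.
  by have [] := classKinf_scale k0.
- move=> r r0; have cr0 : 0 < c * r by rewrite mulr_gt0.
  split.
  + apply: continuous_in_subspaceT => t; rewrite inE /= in_itv /= andbT => t0.
    by rewrite /continuous_at; apply: cvgM; [exact: cvg_cst|exact: pc].
  + by move=> t t0; rewrite mulr_ge0 ?powR_ge0// ltW.
  + move=> s t s0 st; rewrite ltr_pM2l// !powRN ltf_pV2 ?posrE ?powR_gt0 ?ltr_wpDr//.
      by rewrite gt0_ltr_powR// ?nnegrE ?addr_ge0// ?ltrD2l// (le_trans s0) ?ltW.
    by rewrite (le_trans s0)// ltW.
  + rewrite -[X in _ --> X](mulr0 (c * r)); apply: cvgM; first exact: cvg_cst.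
    exact: powR_cvg0.
Qed.

(** * Polynomial input-to-state stability *)

Theorem proposition4p3 (R : realType) (X U : completeNormedModType R[i])
    (A : partial_op X) (T : R -> X -> X) (alpha : R) (B : U -> X)
    (halpha : 0 < alpha)
    (hT : C0_semigroup T)
    (hA : is_generator A T)
    (hstable : polynomially_stable A T alpha)
    (hB : bounded_linear B)
    (hran : exists beta : R, alpha < beta /\ range B `<=` dom (frac_power A beta)) :
  polynomially_ISS A T B alpha.
Proof.
have [[hub _] _] := hstable.
have [M M0 hM] := uniformly_boundedP hT hub.
have [C0 C00 hdec] := generator_decay hT hA M0 hM halpha hstable.
have [beta [ab ranB]] := hran.
have b0 : 0 < beta by exact: lt_trans ab.
have p0 : 0 < alpha^-1 by rewrite invr_gt0.
have [C1 C1_ge0 hfrac] := neg_frac_power_decay hT hA M0 hM C00 (ltW p0) (ltW b0) hdec.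
set d := beta * alpha^-1 in hfrac.
have d1 : 1 < d by rewrite /d ltr_pdivlMr// mul1r.
have [C2 C20 hTB] : exists2 C : R, 0 < C & forall (t : R) u, 0 <= t ->
    nrm (T t (B u)) <= C * (1 + t) `^ (- d) * nrm u.
  apply: (input_decay hT M0 hM hB) => [|u]; first by rewrite (le_trans _ (ltW d1)).
  have [v _ <-] : dom (frac_power A beta) (B u) by apply: ranB; exists u.
  by exists (C1 * nrm v) => t t0; rewrite mulrAC hfrac.
have resp := forced_response_le (ltW C20) d1 hTB.
have c0 : 0 < C2 / (d - 1) by rewrite divr_gt0// subr_gt0.
split.
  exists (fun r => (M + 1) * r), (fun r => C2 / (d - 1) * r); split.
  - by apply: classKinf_scale; rewrite ltr_wpDl.
  - exact: classKinf_scale.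
  move=> x0 u t hu t0; rewrite (le_trans (nrmD _ _))// lerD//; last exact: resp.
  by rewrite (le_trans (hM _ _ t0))// ler_wpM2r ?nrm_ge0// lerDl.
exists (fun r t => C0 * r * (1 + t) `^ (- alpha^-1)), (fun r => C2 / (d - 1) * r); split.
- exact: classKL_powR.
- exact: classKinf_scale.
- move=> x0 u t Ax0 hu t0; rewrite (le_trans (nrmD _ _))// lerD//; last exact: resp.
  rewrite (le_trans (hdec _ _ t0 Ax0))// mulrAC ler_wpM2r ?powR_ge0//.
  by rewrite ler_wpM2l ?(ltW C00)// lerDr nrm_ge0.
- move=> r r0; exists (C0 * r), 1; split; first by rewrite mulr_gt0.
  move=> t t1; rewrite lee_fin ler_wpM2l//; first by rewrite mulr_ge0 ?(ltW C00) ?(ltW r0).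
  by apply: powR_anti; [exact: ltW|exact: lt_le_trans t1|rewrite lerDr].
Qed.
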